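(* There is an absolute constant $c>0$ such that the following holds. Let $\mathsf{M}\ge 1$, $\mathsf{N}\ge 2$ and $\mathsf{T}$ be positive integers with $\mathsf{M}\mathsf{T}\ge \mathsf{N}-1$, and consider the online matrix completion model in which the noise variables are i.i.d. $\mathcal{N}(0,1)$ (so $\sigma^2=1$). Then for every online algorithm there exists a reward matrix $\mathbf{P}\in\mathbb{R}^{\mathsf{M}\times\mathsf{N}}$ of rank at most $1$ with $0\le \mathbf{P}_{ij}\le 1$ for all $(i,j)\in[\mathsf{M}]\times[\mathsf{N}]$ such that the algorithm's regret satisfies $\mathsf{Reg}(\mathsf{T})\ge c\sqrt{\mathsf{N}\mathsf{T}/\mathsf{M}}$.
   Context: Online matrix completion model: there are $\mathsf{M}$ users, $\mathsf{N}$ items and $\mathsf{T}$ rounds, and an unknown reward matrix $\mathbf{P}\in\mathbb{R}^{\mathsf{M}\times\mathsf{N}}$. In each round $t\in[\mathsf{T}]$ an online algorithm selects, for every user $u\in[\mathsf{M}]$, an item $\rho_u(t)\in[\mathsf{N}]$ (possibly at random, and depending only on rewards observed in earlier rounds), and observes $\mathbf{R}^{(t)}_{u\rho_u(t)}=\mathbf{P}_{u\rho_u(t)}+\mathbf{E}^{(t)}_{u\rho_u(t)}$, where the noise variables $\mathbf{E}^{(t)}_{u\rho_u(t)}$, $u\in[\mathsf{M}],t\in[\mathsf{T}]$, are independent, zero-mean and sub-Gaussian with variance proxy $\sigma^2$, i.e. $\mathbb{E}[\exp(s\mathbf{E})]\le\exp(\sigma^2 s^2/2)$ for all $s\in\mathbb{R}$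 (fresh noise at each recommendation, even if an item is recommended repeatedly). Let $\mu^\star_u=\max_{j\in[\mathsf{N}]}\mathbf{P}_{uj}$. The regret is $\mathsf{Reg}(\mathsf{T})=\frac{\mathsf{T}}{\mathsf{M}}\sum_{u\in[\mathsf{M}]}\mu^\star_u-\mathbb{E}\big[\sum_{t\in[\mathsf{T}]}\frac{1}{\mathsf{M}}\sum_{u\in[\mathsf{M}]}\mathbf{R}^{(t)}_{u\rho_u(t)}\big]$, the expectation being over the noise and the algorithm's randomness. *)

(* Defs.v *)
From HB Require Import structures.
From mathcomp Require Import all_boot all_order all_algebra.
From mathcomp Require Import all_classical all_reals all_analysis.
Set Implicit Arguments. Unset Strict Implicit. Unset Printing Implicit Defensive.
Import Order.TTheory GRing.Theory Num.Theory.
Local Open Scope ring_scope.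
Local Open Scope ereal_scope.

Section OnlineMC.
Context {R : realType}.

(** A joint recommendation in one round: an item for every user. *)
Definition action (M N : nat) := {ffun 'I_M -> 'I_N}.

Definition obs (M : nat) := M.-tuple R.

(** Iterated Gaussian expectation: y_i ~ N(mu_i, 1) independent,
    gint mu f = E[f y], computed as iterated one-dimensional integrals
    against the normal probability measures (standard deviation 1). *)
Fixpoint gint (n : nat) : n.-tuple R -> (n.-tuple R -> \bar R) -> \bar R :=
  match n return n.-tuple R -> (n.-tuple R -> \bar R) -> \bar R with
  | 0 => fun _ f => f [tuple]
  | n'.+1 => fun mu f =>
      \int[normal_prob (thead mu) 1%R]_x
        gint [tuple of behead mu] (fun y : n'.-tuple R => f [tuple of x :: y])
  end.

(** An online (possibly randomized) algorithm: in round t (0-based), given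
    its own past recommendations and the past observed rewards, it draws
    the joint recommendation from a probability vector over actions.
    The policy must be measurable in the observed rewards. *)
Record algorithm (M N : nat) := Algorithm {
  policy : forall t : nat, t.-tuple (action M N) -> t.-tuple (obs M) ->
           action M N -> R ;
  policy_ge0 : forall t (h : t.-tuple (action M N)) (ys : t.-tuple (obs M)) a, (0 <= policy h ys a)%R ;
  policy_sum1 : forall t (h : t.-tuple (action M N)) (ys : t.-tuple (obs M)), (\sum_(a : action M N) policy h ys a)%R = 1%R ;
  policy_meas : forall t (h : t.-tuple (action M N)) (a : action M N),
      measurable_fun [set: t.-tuple (M.-tuple R)] (fun ys : t.-tuple (M.-tuple R) => policy h ys a)
}.

Definition means M N (P : 'M[R]_(M, N)) (a : action M N) : M.-tuple R :=
  [tuple P i (a i) | i < M].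

Definition avg_obs M (y : M.-tuple R) : R :=
  ((M%:R)^-1 * \sum_(i < M) tnth y i)%R.

(** val A P k t h ys = expected sum over the next k rounds (rounds t,...,t+k-1)
    of (1/M) sum_u R^{(s)}_{u rho_u(s)}, given history (h, ys) of length t. *)
Fixpoint val M N (A : algorithm M N) (P : 'M[R]_(M, N)) (k : nat) :
    forall t, t.-tuple (action M N) -> t.-tuple (obs M) -> \bar R :=
  match k with
  | 0 => fun _ _ _ => 0
  | k'.+1 => fun t h ys =>
      \sum_(a : action M N)
        (policy A h ys a)%:E *
        gint (means P a)
          (fun y => (avg_obs y)%:E +
                    val A P k' [tuple of rcons h a] [tuple of rcons ys y])
  end.

Definition mustar M N (P : 'M[R]_(M, N)) (u : 'I_M) : \bar R :=
  \big[maxe/-oo]_(j < N) (P u j)%:E.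

Definition regret M N (A : algorithm M N) (P : 'M[R]_(M, N)) (T : nat) : \bar R :=
  (T%:R / M%:R)%:E * (\sum_(u < M) mustar P u) - val A P T [tuple] [tuple].

End OnlineMC.

(* Main.v *)
(** All users are given the same arms, of mean [Delta] for one hidden item [j]
    and [0] for the others, with [Delta] of order [sqrt (N / (M T))]; the matrix
    has rank one and the problem becomes an [N]-armed bandit with [M T] pulls.
    By the Donsker-Varadhan inequality, [exp] of the expectation of
    [s * regret - log-likelihood ratio] under the zero matrix is at most the
    expectation of [exp (s * regret)] under the [j]-th matrix, and the latter is
    linear in the regret once [s * regret <= 1/2].  Each pull of [j] costs
    [Delta ^ 2 / 2] in relative entropy.  Under the zero matrix, these exponents
    summed over [j] do not depend on the algorithm, so some [j] has a large one.
    The inequality is proved by backward induction on the number of remaining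
    rounds, which avoids constructing the law of the whole trajectory. *)
Require Import Defs.
From HB Require Import structures.
From mathcomp Require Import all_boot all_order all_algebra.
From mathcomp Require Import all_classical all_reals all_analysis.
From mathcomp Require Import measurable_realfun ring lra.
Import Order.TTheory GRing.Theory Num.Theory.
Set Implicit Arguments.
Unset Strict Implicit.
Unset Printing Implicit Defensive.
Local Open Scope ring_scope.

(** * One-dimensional unit-variance Gaussian integrals: change of mean, first moment, entropy
    inequality *)

Section Gaussian.
Context {R : realType}.
Implicit Types (m t x : R).
Local Notation mu := (@lebesgue_measure R).
Local Notation gauss m := (normal_prob m (1 : R)).

Lemma integral_normal_prob_cst m (c : R) : (\int[gauss m]_x c%:E = c%:E)%E.
Proof. by rewrite integral_cst//= probability_setT mule1. Qed.

Lemma integrable_normal_prob_cst m (c : R) :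
  (gauss m).-integrable [set: R] (fun=> c%:E).
Proof. exact: finite_measure_integrable_cst. Qed.

(** The Radon-Nikodym derivative of the normal law and its explicit density have the same integral
    over every measurable set, hence agree almost everywhere. *)
Lemma ge0_integral_normal_prob m (f : R -> \bar R) :
  measurable_fun [set: R] f -> (forall x, 0 <= f x)%E ->
  (\int[gauss m]_x f x = \int[mu]_x (f x * (normal_pdf m 1 x)%:E))%E.
Proof.
move=> mf f0; have dom := normal_prob_dominates m (1 : R).
rewrite -(Radon_Nikodym_SigmaFinite.change_of_variables dom f0)//.
have fint := Radon_Nikodym_SigmaFinite.f_integrable dom.
have fge0 := Radon_Nikodym_SigmaFinite.f_ge0 dom.
have mpdf : measurable_fun [set: R] (fun x => (normal_pdf m 1 x)%:E).
  by apply/measurable_EFinP; exact: measurable_normal_pdf.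
apply: ge0_ae_eq_integral => //.
- by apply: emeasurable_funM => //; exact: measurable_int fint.
- exact: emeasurable_funM.
- by move=> x _; rewrite mule_ge0.
- by move=> x _; rewrite mule_ge0// lee_fin normal_pdf_ge0.
- apply: ae_eqe_mul2l; apply: integral_ae_eq => //.
  by move=> E _ mE; rewrite -Radon_Nikodym_SigmaFinite.f_integral.
Qed.

(** The exponential factor, called the tilt below, is the likelihood ratio of N(m + t, 1) to N(m,
    1). *)
Lemma normal_pdf_shift m t x :
  normal_pdf (m + t) 1 x
  = expR (t * (x - m) - t ^+ 2 / 2) * normal_pdf m 1 x.
Proof.
rewrite !normal_pdfE ?oner_neq0// /normal_fun mulrCA -expRD.
by congr (_ * expR _); rewrite expr1n; field.
Qed.

Lemma measurable_tilt m t :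
  measurable_fun [set: R] (fun x => expR (t * (x - m) - t ^+ 2 / 2)).
Proof.
apply: measurableT_comp => //; apply: measurable_funB => //.
by apply: measurable_funM => //; exact: measurable_funB.
Qed.

Lemma ge0_integral_normal_prob_shift m t (f : R -> R) :
  measurable_fun [set: R] f -> (forall x, 0 <= f x) ->
  (\int[gauss (m + t)]_x (f x)%:E
   = \int[gauss m]_x (f x * expR (t * (x - m) - t ^+ 2 / 2))%:E)%E.
Proof.
move=> mf f0; have mft := measurable_funM mf (measurable_tilt m t).
apply: etrans (esym (@ge0_integral_normal_prob m
    (EFin \o (fun x => f x * expR (t * (x - m) - t ^+ 2 / 2))) _ _)).
- apply: etrans (@ge0_integral_normal_prob (m + t) (EFin \o f) _ _) _.
  + exact/measurable_EFinP.
  + by move=> x; rewrite lee_fin.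
  + by apply: eq_integral => x _; rewrite -!EFinM normal_pdf_shift mulrA.
- exact/measurable_EFinP.
- by move=> x; rewrite lee_fin mulr_ge0// expR_ge0.
Qed.

Lemma integral_tilt m t :
  (\int[gauss m]_x (expR (t * (x - m) - t ^+ 2 / 2))%:E = 1)%E.
Proof.
apply: etrans (integral_normal_prob_cst (m + t) 1).
apply: etrans (esym (@ge0_integral_normal_prob_shift m t (cst 1) _ _)).
- by apply: eq_integral => x _; rewrite mul1r.
- exact: measurable_cst.
- by move=> x; exact: ler01.
Qed.

Lemma ge0_integrable_normal_prob m (f : R -> R) :
  measurable_fun [set: R] f -> (forall x, 0 <= f x) ->
  (\int[gauss m]_x (f x)%:E < +oo)%E ->
  (gauss m).-integrable [set: R] (fun x => (f x)%:E).
Proof.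
move=> mf f0 fy; apply/integrableP; split; first exact/measurable_EFinP.
apply: le_lt_trans fy; rewrite le_eqVlt; apply/orP; left; apply/eqP.
by apply: eq_integral => x _; rewrite /= ger0_norm.
Qed.

Lemma integrable_tilt m t : (gauss m).-integrable [set: R]
  (fun x => (expR (t * (x - m) - t ^+ 2 / 2))%:E).
Proof.
apply: ge0_integrable_normal_prob.
- exact: measurable_tilt.
- by move=> x; exact: expR_ge0.
- by rewrite integral_tilt ltry.
Qed.

(** With [u = x - m], [|u| <= expR u + expR (- u)]; the right side is [expR (1 / 2)] times the sum
    of the tilts for [t = 1] and [t = -1]. *)
Lemma integrable_centered m :
  (gauss m).-integrable [set: R] (fun x => (x - m)%:E).
Proof.
have h := integrableD measurableT (integrable_tilt m 1) (integrable_tilt m (-1)).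
have := integrableZl measurableT (expR (1 / 2)) h.
apply: le_integrable => //=.
  by apply/measurable_EFinP; exact: measurable_funB.
move=> x _; rewrite /= lee_fin mulrDr -!expRD.
have -> : 1 / 2 + (1 * (x - m) - 1 ^+ 2 / 2) = x - m by field.
have -> : 1 / 2 + (-1 * (x - m) - (-1) ^+ 2 / 2) = - (x - m) by field.
have := expR_ge1Dx (x - m); have := expR_ge1Dx (- (x - m)).
have := expR_gt0 (x - m); have := expR_gt0 (- (x - m)).
move=> a b c d; rewrite [leRHS]ger0_norm; last by lra.
by rewrite ler_norml; lra.
Qed.

(* The tilt integrates to [1] for every [t] and dominates
   [1 + t * (x - m) - t ^+ 2 / 2], so the mean [e] of [x - m] satisfies
   [t * e <= t ^+ 2 / 2] for all [t], of either sign. *)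
Lemma integral_centered m : (\int[gauss m]_x (x - m)%:E = 0)%E.
Proof.
have fin := integrable_fin_num measurableT (integrable_centered m).
rewrite -(fineK fin); set e := fine _; congr EFin.
have key t : 1 + t * e - t ^+ 2 / 2 <= 1.
  rewrite -lee_fin -(integral_tilt m t).
  have -> : (1 + t * e - t ^+ 2 / 2)%:E =
     (\int[gauss m]_x ((1 - t ^+ 2 / 2)%:E + t%:E * (x - m)%:E))%E.
    rewrite integralD//.
    - rewrite integral_normal_prob_cst integralZl//.
      + by rewrite -(fineK fin) -/e -EFinM -EFinD; congr EFin; ring.
      + exact: integrable_centered.
    - exact: integrable_normal_prob_cst.
    - by apply: integrableZl => //; exact: integrable_centered.
  apply: le_integral => //.
  - apply: integrableD => //; first exact: integrable_normal_prob_cst.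
    by apply: integrableZl => //; exact: integrable_centered.
  - exact: integrable_tilt.
  - move=> x _; rewrite -EFinM -EFinD lee_fin.
    by have := expR_ge1Dx (t * (x - m) - t ^+ 2 / 2); lra.
(* Taking [t = e] leaves [e ^+ 2 <= e ^+ 2 / 2]. *)
by have := key e; nra.
Qed.

Lemma integrable_normal_id m :
  (gauss m).-integrable [set: R] (fun x => x%:E).
Proof.
have := integrableD measurableT (integrable_centered m)
  (integrable_normal_prob_cst m m).
by apply: eq_integrable => // x _ /=; rewrite -EFinD subrK.
Qed.

Lemma integral_normal_id m : (\int[gauss m]_x x%:E = m%:E)%E.
Proof.
transitivity (\int[gauss m]_x ((x - m)%:E + m%:E))%E.
  by apply: eq_integral => x _; rewrite -EFinD subrK.
rewrite integralD//; [|exact: integrable_centered|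
  exact: integrable_normal_prob_cst].
by rewrite integral_centered add0e integral_normal_prob_cst.
Qed.

Lemma integrable_affine_add m a b (g : R -> R) :
  (gauss m).-integrable [set: R] (fun x => (g x)%:E) ->
  (gauss m).-integrable [set: R] (fun x => (a + b * x + g x)%:E).
Proof.
move=> ig.
have := integrableD measurableT (integrableD measurableT
  (integrable_normal_prob_cst m a)
  (integrableZl measurableT b (integrable_normal_id m))) ig.
by apply: eq_integrable.
Qed.

Lemma integral_affine_add m a b (g : R -> R) :
  (gauss m).-integrable [set: R] (fun x => (g x)%:E) ->
  (\int[gauss m]_x (a + b * x + g x)%:E
   = (a + b * m)%:E + \int[gauss m]_x (g x)%:E)%E.
Proof.
move=> ig.
have i1 := integrable_normal_prob_cst m a.
have i2 := integrableZl measurableT b (integrable_normal_id m).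
transitivity (\int[gauss m]_x (a%:E + b%:E * x%:E + (g x)%:E))%E.
  exact: eq_integral.
rewrite (integralD measurableT (integrableD measurableT i1 i2) ig).
rewrite (integralD measurableT i1 i2) integral_normal_prob_cst.
by rewrite (integralZl measurableT (integrable_normal_id m)) integral_normal_id.
Qed.

(* [expR] lies above its tangent at the mean of [g - t ^+ 2 / 2], and the
   linear term of the tilt integrates to zero. *)
Lemma gauss_entropy_bound t (g H : R -> R) :
  (gauss 0).-integrable [set: R] (fun x => (g x)%:E) ->
  (gauss t).-integrable [set: R] (fun x => (H x)%:E) ->
  (forall x, expR (g x) <= H x) ->
  ((expR (fine (\int[gauss 0]_x (g x)%:E) - t ^+ 2 / 2))%:E
   <= \int[gauss t]_x (H x)%:E)%E.
Proof.
move=> ig iH gH.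
have mH : measurable_fun [set: R] H 
  by apply/measurable_EFinP; exact: measurable_int iH.
have H0 x : 0 <= H x by exact: le_trans (expR_ge0 _) (gH x).
have HE := ge0_integral_normal_prob_shift 0 t mH H0.
rewrite add0r in HE.
have fin := integrable_fin_num measurableT ig.
set e := fine _; have eE : (\int[gauss 0]_x (g x)%:E = e%:E)%E by rewrite fineK.
set c := e - t ^+ 2 / 2.
have HEy : (\int[gauss 0]_x (H x * expR (t * (x - 0) - t ^+ 2 / 2))%:E < +oo)%E.
  rewrite -HE; have := integrable_fin_num measurableT iH.
  by rewrite fin_numElt => /andP[].
rewrite HE; clear HE iH.
have i1 := integrable_affine_add (1 - e) t ig.
have i2 := integrableZl measurableT (expR c) i1.
(* The second factor has mean 1 under N(0, 1), and the product is the tangent to [expR] at [c],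
   evaluated at [g x + t * x - t ^+ 2 / 2]. *)
have -> : (expR c)%:E = (\int[gauss 0]_x
    ((expR c)%:E * (1 - e + t * x + g x)%:E))%E.
  rewrite (integralZl measurableT i1) (integral_affine_add _ _ ig) eE.
  by rewrite -EFinD -EFinM; congr EFin; ring.
apply: le_integral => //.
- apply: ge0_integrable_normal_prob.
  + by apply: measurable_funM => //; exact: measurable_tilt.
  + by move=> x; rewrite mulr_ge0 ?expR_ge0.
  + exact: HEy.
- move=> x _; rewrite -EFinM lee_fin.
  apply: le_trans (ler_wpM2r (expR_ge0 _) (gH x)).
  rewrite -expRD.
  have -> : g x + (t * (x - 0) - t ^+ 2 / 2) = c + (g x + t * x - t ^+ 2 / 2 - c).
    by ring.
  rewrite [leRHS]expRD ler_pM2l ?expR_gt0//.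
  by have := expR_ge1Dx (g x + t * x - t ^+ 2 / 2 - c); rewrite /c; lra.
Qed.

End Gaussian.

(** * Closure properties of bounded measurable functions *)

Section BoundedMeasurable.
Context {R : realType}.

Definition bmeas d (T : measurableType d) (f : T -> R) :=
  measurable_fun [set: T] f /\ exists K, forall x, `|f x| <= K.

Lemma bmeas_cst d (T : measurableType d) (k : R) : bmeas (fun _ : T => k).
Proof. by split=> //; exists `|k|. Qed.

Lemma bmeasD d (T : measurableType d) (f g : T -> R) :
  bmeas f -> bmeas g -> bmeas (fun x => f x + g x).
Proof.
move=> [mf [K fK]] [mg [L gL]]; split; first exact: measurable_funD.
by exists (K + L) => x; rewrite (le_trans (ler_normD _ _))// lerD.
Qed.

Lemma bmeasM d (T : measurableType d) (f g : T -> R) :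
  bmeas f -> bmeas g -> bmeas (fun x => f x * g x).
Proof.
move=> [mf [K fK]] [mg [L gL]]; split; first exact: measurable_funM.
by exists (K * L) => x; rewrite normrM ler_pM.
Qed.

Lemma bmeas_sum d (T : measurableType d) (I : Type) (s : seq I)
    (f : I -> T -> R) :
  (forall i, bmeas (f i)) -> bmeas (fun x => \sum_(i <- s) f i x).
Proof.
move=> bf; elim: s => [|i s IH].
  by under eq_fun do rewrite big_nil; exact: bmeas_cst.
by under eq_fun do rewrite big_cons; exact: bmeasD.
Qed.

Lemma bmeas_comp d d' (T : measurableType d) (U : measurableType d')
    (f : T -> R) (h : U -> T) :
  bmeas f -> measurable_fun [set: U] h -> bmeas (fun u => f (h u)).
Proof.
move=> [mf [K fK]] mh; split; first exact: (measurableT_comp mf mh).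
by exists K => u; exact: fK.
Qed.

End BoundedMeasurable.

(** * Iterated Gaussian expectations and the entropy inequality in dimension [n] *)

Section GaussianVectors.
Context {R : realType}.
Local Notation gauss m := (normal_prob m (1 : R)).

Lemma integrable_bmeas m (f : R -> R) : bmeas f ->
  (gauss m).-integrable [set: R] (fun x => (f x)%:E).
Proof.
move=> [mf [K fK]].
have := integrable_normal_prob_cst m K.
apply: le_integrable => //; first exact/measurable_EFinP.
by move=> x _; rewrite /= lee_fin (le_trans (fK x))// ler_norm.
Qed.

Lemma integral_bmeas_fin m (f : R -> R) : bmeas f ->
  (\int[gauss m]_x (f x)%:E = (fine (\int[gauss m]_x (f x)%:E))%:E)%E.
Proof.
by move=> bf; rewrite fineK// (integrable_fin_num measurableT)//; exact: integrable_bmeas.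
Qed.

Lemma bmeas_integral d (T : measurableType d) m (f : T * R -> R) : bmeas f ->
  bmeas (fun t => fine (\int[gauss m]_x (f (t, x))%:E)).
Proof.
move=> bf; have [mf [K fK]] := bf.
have bft t : bmeas (fun x => f (t, x)).
  by apply: (bmeas_comp bf); exact: measurable_pair1.
split.
  (* Adding the bound [K] makes the integrand nonnegative, so that Tonelli gives measurability of
     the partial integral. *)
  have bfK : bmeas (fun p => f p + K) by apply: bmeasD => //; exact: bmeas_cst.
  have E t : fine (\int[gauss m]_x (f (t, x))%:E) =
      fine (\int[gauss m]_x (f (t, x) + K)%:E) - K.
    have := integral_affine_add K 0 (integrable_bmeas m (bft t)).
    rewrite mul0r addr0 (integral_bmeas_fin _ (bft t)) -EFinD => Eq.
    have -> : (\int[gauss m]_x (f (t, x) + K)%:E =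
        \int[gauss m]_x (K + 0 * x + f (t, x))%:E)%E.
      by apply: eq_integral => x _; rewrite mul0r addr0 addrC.
    by rewrite Eq /= addrC addKr.
  rewrite (funext E); apply: measurable_funB => //.
  apply: (measurableT_comp (fine_measurable measurableT)).
  have mfK : measurable_fun [set: T * R] (fun p => (f p + K)%:E).
    by apply/measurable_EFinP; case: bfK.
  have fK0 p : (0 <= (f p + K)%:E)%E.
    by rewrite lee_fin; have /ler_normlP[] := fK p; lra.
  exact: (@measurable_fun_fubini_tonelli_F _ _ _ _ _ (gauss m) _ mfK fK0).
exists K => t; rewrite -lee_fin.
have fin := integrable_fin_num measurableT (integrable_bmeas m (bft t)).
rewrite -(abse_EFin (fine _)) (fineK fin).
apply: le_trans (le_abse_integral _ _ _) _ => //.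
  by apply/measurable_EFinP; case: (bft t).
rewrite -(integral_normal_prob_cst m K); apply: ge0_le_integral => //.
- by apply/measurable_EFinP/measurableT_comp => //; case: (bft t).
- by move=> x _; rewrite lee_fin; exact: fK.
Qed.

Lemma measurable_tuple_cons n :
  measurable_fun [set: R * n.-tuple R] (fun p => [tuple of p.1 :: p.2]).
Proof. exact: measurable_cons. Qed.

(** Real-valued counterpart of [gint]: for bounded measurable integrands every inner integral is
    finite, so [fine] loses nothing. *)
Fixpoint gE n : n.-tuple R -> (n.-tuple R -> R) -> R :=
  match n with
  | 0 => fun _ f => f [tuple]
  | n'.+1 => fun mu f =>
      fine (\int[gauss (thead mu)]_x
        (gE [tuple of behead mu] (fun y => f [tuple of x :: y]))%:E)
  end.

(** The parameter space [T] is arbitrary because the induction moves the first coordinate into it,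
    replacing [T] by [T * R]. *)
Lemma bmeas_gE n d (T : measurableType d) (mu : n.-tuple R)
    (f : T -> n.-tuple R -> R) :
  bmeas (fun p : T * n.-tuple R => f p.1 p.2) -> bmeas (fun t => gE mu (f t)).
Proof.
elim: n d T mu f => [|n IH] d T mu f bf /=.
  apply: (bmeas_comp bf (h := fun t => (t, [tuple] : 0.-tuple R))).
  exact: measurable_pair2.
apply: (@bmeas_integral _ _ (thead mu)
  (fun p => gE [tuple of behead mu] (fun y => f p.1 [tuple of p.2 :: y]))).
apply: (IH _ _ _ (fun p y => f p.1 [tuple of p.2 :: y])).
apply: (bmeas_comp bf (h := fun q : (T * R) * n.-tuple R =>
  (q.1.1, [tuple of q.1.2 :: q.2]))).
apply: measurable_fun_pair.
  exact: (measurableT_comp measurable_fst measurable_fst).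
apply: measurable_cons => //.
exact: (measurableT_comp measurable_snd measurable_fst).
Qed.

Lemma bmeas_gE_cons n (mu : n.-tuple R) (f : n.+1.-tuple R -> R) :
  bmeas f -> bmeas (fun x => gE mu (fun y => f [tuple of x :: y])).
Proof.
move=> bf.
apply: (@bmeas_gE _ _ _ mu (fun (x : R) (y : n.-tuple R) => f [tuple of x :: y])).
exact: (bmeas_comp bf (@measurable_tuple_cons n)).
Qed.

Lemma bmeas_cons n (x : R) (f : n.+1.-tuple R -> R) :
  bmeas f -> bmeas (fun y : n.-tuple R => f [tuple of x :: y]).
Proof. by move=> bf; apply: (bmeas_comp bf); exact: measurable_cons. Qed.

Lemma sum_tnth_cons n (x : R) (y : n.-tuple R) :
  \sum_i tnth [tuple of x :: y] i = x + \sum_i tnth y i.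
Proof.
by rewrite big_ord_recl tnth0; congr (_ + _); apply: eq_bigr => i _; rewrite tnthS.
Qed.

Lemma sum_tnth_eta n (F : R -> R) (t : n.+1.-tuple R) :
  \sum_i F (tnth t i) = F (thead t) + \sum_i F (tnth [tuple of behead t] i).
Proof.
rewrite big_ord_recl; congr (_ + _); apply: eq_bigr => i _.
by rewrite [in LHS](tuple_eta t) tnthS.
Qed.

(** Observed rewards are unbounded, so their linear part is integrated apart, by the Gaussian mean;
    only the bounded remainder passes to [gE]. *)
Lemma gint_affine n (mu : n.-tuple R) (a c : R) (f : n.-tuple R -> R) :
  bmeas f ->
  gint mu (fun y => (a + c * (\sum_i tnth y i) + f y)%:E)
  = (a + c * (\sum_i tnth mu i) + gE mu f)%:E.
Proof.
elim: n mu a f => [|n IH] mu a f bf /=; first by rewrite !big_ord0.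
have bg := bmeas_gE_cons [tuple of behead mu] bf.
rewrite (sum_tnth_eta id) /=.
transitivity (\int[gauss (thead mu)]_x
   (a + c * (\sum_i tnth [tuple of behead mu] i) + c * x
     + gE [tuple of behead mu] (fun y => f [tuple of x :: y]))%:E)%E.
  apply: eq_integral => x _.
  rewrite -[in RHS](addrA a) [in RHS](addrC (c * _)) addrA -IH; last exact: bmeas_cons.
  by congr gint; apply/funext => y; rewrite sum_tnth_cons mulrDr !addrA.
rewrite integral_affine_add; last exact: integrable_bmeas.
rewrite [X in (_ + X)%E](integral_bmeas_fin _ bg) -EFinD.
by congr EFin; rewrite mulrDr; ring.
Qed.

Lemma gE_cst n (mu : n.-tuple R) (k : R) : gE mu (fun=> k) = k.
Proof.
by elim: n mu => [//|n IH] mu /=; under eq_integral do rewrite IH; rewrite integral_normal_prob_cst.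
Qed.

Lemma gED n (mu : n.-tuple R) (f g : n.-tuple R -> R) : bmeas f -> bmeas g ->
  gE mu (fun y => f y + g y) = gE mu f + gE mu g.
Proof.
elim: n mu f g => [//|n IH] mu f g bf bg /=.
have bf' := bmeas_gE_cons [tuple of behead mu] bf.
have bg' := bmeas_gE_cons [tuple of behead mu] bg.
apply: EFin_inj; rewrite EFinD -(integral_bmeas_fin _ bf') -(integral_bmeas_fin _ bg').
rewrite -(integralD measurableT (integrable_bmeas _ bf') (integrable_bmeas _ bg')).
rewrite [RHS](integral_bmeas_fin _ (bmeasD bf' bg')).
apply: congr1; apply: congr1; apply: eq_integral => x _; apply: congr1.
by apply: IH; exact: bmeas_cons.
Qed.

Lemma gEZ n (mu : n.-tuple R) (k : R) (f : n.-tuple R -> R) : bmeas f ->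
  gE mu (fun y => k * f y) = k * gE mu f.
Proof.
elim: n mu f => [//|n IH] mu f bf /=.
have bf' := bmeas_gE_cons [tuple of behead mu] bf.
apply: EFin_inj; rewrite EFinM -(integral_bmeas_fin _ bf').
rewrite -(integralZl measurableT (integrable_bmeas _ bf')).
rewrite [RHS](integral_bmeas_fin _ (bmeasM (bmeas_cst _ k) bf')).
apply: congr1; apply: congr1; apply: eq_integral => x _; apply: congr1.
by apply: IH; exact: bmeas_cons.
Qed.

Lemma gE_affine n (mu : n.-tuple R) (a b : R) (f : n.-tuple R -> R) :
  bmeas f -> gE mu (fun y => a + b * f y) = a + b * gE mu f.
Proof.
move=> bf; rewrite gED; first by rewrite gE_cst gEZ.
- exact: bmeas_cst.
- by apply: bmeasM => //; exact: bmeas_cst.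
Qed.

Lemma gE_sum n (mu : n.-tuple R) (I : Type) (s : seq I)
    (f : I -> n.-tuple R -> R) : (forall i, bmeas (f i)) ->
  gE mu (fun y => \sum_(i <- s) f i y) = \sum_(i <- s) gE mu (f i).
Proof.
move=> bf; elim: s => [|i s IH].
  by under eq_fun do rewrite big_nil; rewrite gE_cst big_nil.
under eq_fun do rewrite big_cons.
by rewrite gED ?IH ?big_cons//; exact: bmeas_sum.
Qed.

(** The offset [S] carries the entropy cost of the coordinates already integrated; it is written
    [S *+ 2] under the division by 2 so that costs add up as squares. *)
Lemma gauss_entropy_bmeas t S (g H : R -> R) : bmeas g -> bmeas H ->
  (forall x, expR (g x - S) <= H x) ->
  expR (fine (\int[gauss 0]_x (g x)%:E) - (t ^+ 2 + S *+ 2) / 2)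
  <= fine (\int[gauss t]_x (H x)%:E).
Proof.
move=> bg bH gH.
have i1 := integral_affine_add (- S) 0 (integrable_bmeas 0 bg).
have e1 := etrans (congr1 fine i1)
  (congr1 (fun u => fine (_ + u)%E) (integral_bmeas_fin 0 bg)).
rewrite /= mul0r addr0 in e1.
have gH' x : expR (- S + 0 * x + g x) <= H x.
  by rewrite mul0r addr0 addrC.
have h := gauss_entropy_bound (integrable_affine_add (- S) 0 (integrable_bmeas 0 bg))
  (integrable_bmeas t bH) gH'.
have arith a b : a = - S + b -> b - (t ^+ 2 + S *+ 2) / 2 <= a - t ^+ 2 / 2.
  by rewrite -mulr_natr => ->; lra.
rewrite -lee_fin; apply: le_trans (le_trans _ h) _.
  by rewrite lee_fin ler_expR; apply: arith e1.
rewrite le_eqVlt; apply/orP; left; apply/eqP; exact: integral_bmeas_fin.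
Qed.

(** Half the squared norm of [t] is the relative entropy between the two Gaussian vectors;
    coordinates are treated one at a time. Assuming only [expR (g y) <= H y] lets [H] be a linear
    upper bound, as the induction over rounds requires. *)
Lemma gE_entropy_bound n (z t : n.-tuple R) (g H : n.-tuple R -> R) :
  (forall i, tnth z i = 0) -> bmeas g -> bmeas H ->
  (forall y, expR (g y) <= H y) ->
  expR (gE z g - (\sum_i tnth t i ^+ 2) / 2) <= gE t H.
Proof.
elim: n z t g H => [|n IH] z t g H z0 bg bH gH /=.
  by rewrite big_ord0 mul0r subr0.
have z0' : thead z = 0 by exact: z0.
rewrite (sum_tnth_eta (fun u => u ^+ 2)) z0'.
have bg' := bmeas_gE_cons [tuple of behead z] bg.
have bH' := bmeas_gE_cons [tuple of behead t] bH.
set S := \sum_i _.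
have -> : S = (S / 2) *+ 2 by rewrite -mulr_natr divfK// pnatr_eq0.
apply: gauss_entropy_bmeas => // x; apply: IH.
- by move=> i; have := z0 (lift ord0 i); rewrite {1}(tuple_eta z) tnthS.
- exact: bmeas_cons.
- exact: bmeas_cons.
- by move=> y; exact: gH.
Qed.

End GaussianVectors.

(** * Expected totals over the remaining rounds and the exponential inequality for them *)

Section BanditValue.
Context {R : realType} (M N : nat) (A : @algorithm R M N).
Implicit Types (P : 'M[R]_(M, N)) (r q : action M N -> R).

(** The round reward [r] is a free function of the action, so one recursion serves for the mean
    reward under a spike and for the exponent under the zero matrix. *)
Fixpoint ev P r (k : nat) :
    forall t, t.-tuple (action M N) -> t.-tuple (M.-tuple R) -> R :=
  match k with
  | 0 => fun _ _ _ => 0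
  | k'.+1 => fun t h ys =>
      \sum_(a : action M N) policy A h ys a *
        (r a + gE (means P a)
          (fun y => ev P r k' [tuple of rcons h a] [tuple of rcons ys y]))
  end.

Lemma bmeas_policy t (h : t.-tuple (action M N)) a :
  bmeas (fun ys : t.-tuple (M.-tuple R) => policy A h ys a).
Proof.
split; first exact: policy_meas.
exists 1 => ys; rewrite ger0_norm ?policy_ge0//.
rewrite -(policy_sum1 A h ys) (bigD1 a)//= lerDl.
by apply: sumr_ge0 => b _; exact: policy_ge0.
Qed.

Lemma measurable_tuple_rcons d (T : measurableType d) t :
  measurable_fun [set: t.-tuple T * T] (fun p => [tuple of rcons p.1 p.2]).
Proof.
apply/measurable_fun_tnthP => i.
have [it|ti] := ltnP i t.
- rewrite (_ : _ \o _ = fun p : t.-tuple T * T => tnth p.1 (Ordinal it)).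
    exact: (measurableT_comp (measurable_tnth (Ordinal it)) measurable_fst).
  apply/funext => p /=.
  by rewrite !(tnth_nth p.2) /= nth_rcons size_tuple it.
- rewrite (_ : _ \o _ = snd); first exact: measurable_snd.
  apply/funext => p /=.
  rewrite (tnth_nth p.2) /= nth_rcons size_tuple ltnNge ti /=.
  by case: eqP => // /eqP; rewrite eqn_leq ti andbT -ltnS ltn_ord.
Qed.

Lemma bmeas_ev P r k t (h : t.-tuple (action M N)) : bmeas (ev P r k h).
Proof.
elim: k t h => [|k IH] t h /=; first exact: bmeas_cst.
apply: bmeas_sum => a; apply: bmeasM; first exact: bmeas_policy.
apply: bmeasD; first exact: bmeas_cst.
have := @bmeas_gE R M _ (t.-tuple (M.-tuple R)) (means P a) (fun ys y =>
  ev P r k [tuple of rcons h a] [tuple of rcons ys y]).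
apply.
exact: (bmeas_comp (IH _ [tuple of rcons h a]) (@measurable_tuple_rcons _ _ t)).
Qed.

Lemma bmeas_ev_next P r k t (h : t.-tuple (action M N))
    (ys : t.-tuple (M.-tuple R)) a :
  bmeas (fun y => ev P r k [tuple of rcons h a] [tuple of rcons ys y]).
Proof.
apply: (bmeas_comp (bmeas_ev P r k [tuple of rcons h a])
  (h := fun y : M.-tuple R => [tuple of rcons ys y])).
exact: (measurableT_comp (@measurable_tuple_rcons _ _ t) (measurable_pair1 ys)).
Qed.

(** Each observed average is replaced by its conditional mean given the action, which also shows
    that [val] is finite. *)
Lemma valE P k t (h : t.-tuple (action M N)) (ys : t.-tuple (M.-tuple R)) :
  Defs.val A P k h ys
  = (ev P (fun a => (M%:R)^-1 * \sum_i P i (a i)) k h ys)%:E.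
Proof.
elim: k t h ys => [//|k IH] t h ys /=.
rewrite -sumEFin; apply: eq_bigr => a _; rewrite EFinM; congr (_ * _)%E.
have := gint_affine (means P a) 0 (M%:R)^-1
  (bmeas_ev_next P (fun a => (M%:R)^-1 * \sum_i P i (a i)) k h ys a).
have -> : \sum_i tnth (means P a) i = \sum_i P i (a i).
  by apply: eq_bigr => i _; rewrite tnth_mktuple.
rewrite add0r => <-; congr gint; apply/funext => y.
by rewrite IH -EFinD add0r.
Qed.

(** All the terms are taken under the same [P], so linearity lets the rewards be summed round by
    round. *)
Lemma ev_sum (I : finType) P (q : I -> action M N -> R) (C : R) :
  (forall a, \sum_i q i a = C) ->
  forall k t (h : t.-tuple (action M N)) (ys : t.-tuple (M.-tuple R)),
  \sum_i ev P (q i) k h ys = k%:R * C.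
Proof.
move=> qC; elim=> [|k IH] t h ys /=; first by rewrite big1 ?mul0r.
rewrite exchange_big /=; set c := k.+1%:R * C.
rewrite -(mul1r c) -(policy_sum1 A h ys) mulr_suml {}/c.
apply: eq_bigr => a _; rewrite -mulr_sumr; congr (_ * _).
rewrite big_split /= qC -gE_sum; last by move=> i; exact: bmeas_ev_next.
by under eq_fun do rewrite IH; rewrite gE_cst -natr1; ring.
Qed.

(** From [expR (- x) >= 1 - x] one gets [expR x * (1 - x) <= 1], and [(1 + 2 * x) * (1 - x) >= 1] on
    this range. *)
Lemma expR_le1D2x (x : R) : 0 <= x -> x <= 1 / 2 -> expR x <= 1 + 2 * x.
Proof.
move=> x0 x2; have h := expR_ge1Dx (- x).
have e0 := expR_gt0 x; have := expRxMexpNx_1 x.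
by have := ler_wpM2l (ltW e0) h; nra.
Qed.

(** Jensen's inequality, from the tangent to [expR] at the mean [c]; it handles the random draw of
    the action. *)
Lemma expR_convex_sum (I : finType) (p u v : I -> R) :
  (forall i, 0 <= p i) -> \sum_i p i = 1 -> (forall i, expR (u i) <= v i) ->
  expR (\sum_i p i * u i) <= \sum_i p i * v i.
Proof.
move=> p0 p1 uv; set c := \sum_i p i * u i.
have -> : expR c = \sum_i p i * (expR c * (1 + u i - c)).
  transitivity (\sum_i (expR c * (1 - c) * p i + expR c * (p i * u i))).
    by rewrite big_split /= -!mulr_sumr p1 -/c; ring.
  by apply: eq_bigr => i _; ring.
apply: ler_sum => i _; apply: ler_wpM2l => //; apply: le_trans (uv i).
rewrite -[u i in leRHS](addrNK c) expRD mulrC ler_wpM2r ?expR_ge0//.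
by have := expR_ge1Dx (u i - c); lra.
Qed.

(* [x] is the regret already incurred.  In each round the change of means from
   [0] to [P] costs half the squared norm of the means, which [q] subtracts. *)
Lemma ev_exp P r q (s Delta : R) :
  0 <= s -> (forall a, 0 <= r a <= Delta) ->
  (forall a, q a = s * (Delta - r a) - (\sum_i P i (a i) ^+ 2) / 2) ->
  forall k t (h : t.-tuple (action M N)) (ys : t.-tuple (M.-tuple R)) (x : R),
  0 <= x -> s * (x + k%:R * Delta) <= 1 / 2 ->
  expR (s * x + ev 0 q k h ys)
  <= 1 + 2 * s * (x + k%:R * Delta - ev P r k h ys).
Proof.
move=> s0 rD qE; elim=> [|k IH] t h ys x x0 sx /=.
  rewrite mul0r !addr0 subr0 -mulrA; apply: expR_le1D2x.
    exact: mulr_ge0.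
  by move: sx; rewrite mul0r addr0.
have p1 := policy_sum1 A h ys.
have -> : s * x + \sum_a policy A h ys a * (q a + gE (means 0 a)
     (fun y => ev 0 q k [tuple of rcons h a] [tuple of rcons ys y]))
  = \sum_a policy A h ys a * (s * x + (q a + gE (means 0 a)
     (fun y => ev 0 q k [tuple of rcons h a] [tuple of rcons ys y]))).
  under [in RHS]eq_bigr do rewrite mulrDr.
  by rewrite big_split /= -mulr_suml p1 mul1r.
have -> : 1 + 2 * s * (x + k.+1%:R * Delta - \sum_a policy A h ys a *
     (r a + gE (means P a)
     (fun y => ev P r k [tuple of rcons h a] [tuple of rcons ys y])))
  = \sum_a policy A h ys a * (1 + 2 * s * (x + k.+1%:R * Delta) - 2 * s *
     (r a + gE (means P a)
     (fun y => ev P r k [tuple of rcons h a] [tuple of rcons ys y]))).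
  under [in RHS]eq_bigr do rewrite mulrBr (mulrCA _ (2 * s)).
  by rewrite sumrB -mulr_suml p1 mul1r -mulr_sumr; ring.
apply: expR_convex_sum => // [a|a]; first exact: policy_ge0.
have bg := bmeas_ev_next 0 q k h ys a.
have bH := bmeas_ev_next P r k h ys a.
have /andP[r0 r1] := rD a.
(* After action [a] the incurred regret becomes [x + Delta - r a]; [g] and [H] are the two sides of
   the induction hypothesis at this value, in the affine form that [gE_affine] expects. *)
have key := @gE_entropy_bound _ _ (means 0 a) (means P a)
  (fun y => s * (x + Delta - r a) + 1 *
     ev 0 q k [tuple of rcons h a] [tuple of rcons ys y])
  (fun y => (1 + 2 * s * (x + Delta - r a + k%:R * Delta)) + (- (2 * s)) *
     ev P r k [tuple of rcons h a] [tuple of rcons ys y]).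
rewrite (gE_affine _ _ _ bg) (gE_affine _ _ _ bH) in key.
apply: le_trans (le_trans _ (key _ _ _ _)) _.
- have -> : \sum_i tnth (means P a) i ^+ 2 = \sum_i P i (a i) ^+ 2.
    by apply: eq_bigr => i _; rewrite tnth_mktuple.
  rewrite ler_expR qE.
  by rewrite le_eqVlt; apply/orP; left; apply/eqP; ring.
- by move=> i; rewrite tnth_mktuple mxE.
- by apply: bmeasD; [exact: bmeas_cst|apply: bmeasM => //; exact: bmeas_cst].
- by apply: bmeasD; [exact: bmeas_cst|apply: bmeasM => //; exact: bmeas_cst].
- move=> y; rewrite mul1r mulNr -[leRHS]addrA -mulrBr; apply: IH.
    by lra.
  by apply: le_trans sx; apply: ler_wpM2l => //; rewrite -natr1; lra.
- by rewrite -natr1; lra.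
Qed.

End BanditValue.

(** * The rank-one matrices with a single good item *)

Section HardInstance.
Context {R : realType} (M N : nat) (Delta : R).

Definition spike (j : 'I_N) : 'M[R]_(M, N) :=
  \matrix_(i, j') (Delta *+ (j' == j)).

Lemma rank_spike j : (\rank (spike j) <= 1)%N.
Proof.
have -> : spike j = (const_mx 1 : 'cV[R]_M) *m (Delta *: delta_mx 0 j : 'rV[R]_N).
  apply/matrixP => i j'; rewrite !mxE big_ord1 !mxE mul1r mulr_natr.
  by rewrite eqxx.
exact: leq_trans (mxrankM_maxl _ _) (rank_leq_col _).
Qed.

Lemma spike_itv j i j' : 0 <= Delta -> 0 <= spike j i j' <= Delta.
Proof. by move=> D0; rewrite mxE; case: eqP => _; rewrite ?mulr1n ?mulr0n ?D0 ?lexx. Qed.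

Lemma mustar_spike j i : 0 <= Delta -> mustar (spike j) i = Delta%:E.
Proof.
move=> D0; apply/le_anti/andP; split.
  apply: bigmax_le => [|j' _]; first exact: leNye.
  by rewrite lee_fin; have /andP[] := spike_itv j i j' D0.
apply: le_trans (le_bigmax _ (fun j' => (spike j i j')%:E) j).
by rewrite mxE eqxx mulr1n.
Qed.

(** A pulled item is the good one for exactly one spike; this makes sums over the spikes independent
    of the actions. *)
Lemma sum_spike (F : R -> R) (i : 'I_M) (j' : 'I_N) : F 0 = 0 ->
  \sum_j F (spike j i j') = F Delta.
Proof.
move=> F0; rewrite (bigD1 j')//= big1 ?addr0 ?mxE ?eqxx ?mulr1n//.
by move=> j jj'; rewrite mxE eq_sym (negbTE jj') mulr0n.
Qed.

End HardInstance.

(** * Lower bound on the regret summed over the spikes *)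

Section LowerBound.
Context {R : realType} (M N T : nat) (A : @algorithm R M N) (Delta : R).
Hypotheses (M0 : (0 < M)%N) (T0 : (0 < T)%N) (D0 : 0 < Delta).

Definition mean_reward (P : 'M[R]_(M, N)) (a : action M N) : R :=
  (M%:R)^-1 * \sum_i P i (a i).

Lemma regret_spike j :
  regret A (spike M Delta j) T
  = (T%:R * Delta - ev A (spike M Delta j) (mean_reward (spike M Delta j)) T
      [tuple] [tuple])%:E.
Proof.
rewrite /regret valE (eq_bigr (fun=> Delta%:E)); last first.
  by move=> i _; rewrite mustar_spike// ltW.
rewrite sumEFin sumr_const card_ord -EFinM -EFinB.
congr EFin; congr (_ - _).
by rewrite -mulr_natr; field; rewrite pnatr_eq0 -lt0n.
Qed.

Lemma mean_reward_itv j a : 0 <= mean_reward (spike M Delta j) a <= Delta.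
Proof.
have Mgt0 : 0 < M%:R :> R by rewrite ltr0n.
have h i := spike_itv j i (a i) (ltW D0).
apply/andP; split.
  apply: mulr_ge0; first by rewrite invr_ge0 ltW.
  by apply: sumr_ge0 => i _; case/andP: (h i).
rewrite /mean_reward mulrC ler_pdivrMr//; apply: (@le_trans _ _ (\sum_(i < M) Delta)).
  by apply: ler_sum => i _; case/andP: (h i).
by rewrite sumr_const card_ord mulr_natr.
Qed.

(* Under the all-zero matrix the rewards [q j] add up over the [N] spikes to a
   constant, whatever the algorithm does. *)
Lemma sum_regret_spike :
  exists reg : 'I_N -> R,
    (forall j, regret A (spike M Delta j) T = (reg j)%:E) /\
    T%:R * Delta * (N%:R - 1 - T%:R * M%:R * Delta ^+ 2) / 2 <= \sum_j reg j.
Proof.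
exists (fun j => T%:R * Delta - ev A (spike M Delta j)
  (mean_reward (spike M Delta j)) T [tuple] [tuple]); split.
  exact: regret_spike.
have Tgt0 : 0 < T%:R :> R by rewrite ltr0n.
have Mn0 : M%:R != 0 :> R by rewrite pnatr_eq0 -lt0n.
have Tn0 := lt0r_neq0 Tgt0; have Dn0 := lt0r_neq0 D0.
have TD := mulr_gt0 Tgt0 D0.
(* The largest [s] allowed by [ev_exp]: the total regret can reach [T%:R * Delta], and [s] times
   this must be at most 1/2. *)
pose s : R := (2 * (T%:R * Delta))^-1.
pose q j a := s * (Delta - mean_reward (spike M Delta j) a)
  - (\sum_i spike M Delta j i (a i) ^+ 2) / 2.
have s0 : 0 <= s by rewrite invr_ge0; lra.
have sT : s * (0 + T%:R * Delta) <= 1 / 2.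
  by rewrite add0r le_eqVlt; apply/orP; left; apply/eqP; rewrite /s; field; rewrite ?Tn0 ?Dn0.
have qC a : \sum_j q j a = s * (N%:R * Delta - Delta) - M%:R * Delta ^+ 2 / 2.
  have sumM (F : R -> R) : F 0 = 0 ->
      \sum_j \sum_i F (spike M Delta j i (a i)) = M%:R * F Delta.
    move=> F0; rewrite exchange_big /= (eq_bigr (fun=> F Delta)).
      by rewrite sumr_const card_ord mulr_natl.
    by move=> i _; exact: sum_spike.
  rewrite sumrB -mulr_sumr sumrB sumr_const card_ord -mulr_suml -mulr_sumr.
  rewrite (sumM id)// (sumM (fun u => u ^+ 2)) ?expr0n//.
  by rewrite (mulKf Mn0) -(mulr_natl Delta).
have S := ev_sum A 0 qC T [tuple] [tuple].
have -> : T%:R * Delta * (N%:R - 1 - T%:R * M%:R * Delta ^+ 2) / 2 =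
    \sum_j T%:R * Delta * ev A 0 (q j) T [tuple] [tuple].
  by rewrite -mulr_sumr S /s; field; rewrite ?Tn0 ?Dn0.
apply: ler_sum => j _.
have := ev_exp A s0 (mean_reward_itv j) (fun a => erefl (q j a)) [tuple] [tuple]
  (lexx 0) sT.
rewrite mulr0 !add0r; set e := ev _ 0 _ _ _ _; set v := _ - _ => h.
(* Here [v] is the regret on spike [j], and [1 + e <= expR e <= 1 + 2 * s * v]. *)
have {}h : e <= 2 * s * v by have := expR_ge1Dx e; lra.
have -> : v = T%:R * Delta * (2 * s * v) by rewrite /s; field; rewrite ?Tn0 ?Dn0.
by rewrite ler_pM2l.
Qed.

End LowerBound.

Theorem theorem4 :
  exists c : rat, 0 < c /\
  forall (R : realType) (M N T : nat),
    (1 <= M)%N -> (2 <= N)%N -> (0 < T)%N -> (N.-1 <= M * T)%N ->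
    forall A : @algorithm R M N,
    exists P : 'M[R]_(M, N),
      (\rank P <= 1)%N /\
      (forall i j, 0 <= P i j <= 1) /\
      ((ratr c * Num.sqrt (N%:R * T%:R / M%:R))%:E <= regret A P T)%E.
Proof.
(* Some spike has regret at least [T%:R * Delta / 16], and the square root in the bound equals
   [2 * T%:R * Delta]. *)
exists (1 / 32); split; first by [].
move=> R M N T M1 N2 T1 NMT A.
have Mgt0 : 0 < M%:R :> R by rewrite ltr0n.
have Tgt0 : 0 < T%:R :> R by rewrite ltr0n.
have Nge2 : 2 <= N%:R :> R by rewrite (ler_nat _ 2).
have NMT' : N%:R - 1 <= M%:R * T%:R :> R.
  by rewrite -natrM lerBlDr natr1 ler_nat; case: N N2 NMT {A Nge2}.
set w : R := N%:R / (M%:R * T%:R).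
have w0 : 0 < w by rewrite divr_gt0 ?mulr_gt0//; lra.
(* Since [N >= 2], [N <= 2 * (N - 1) <= 2 * M * T]; this is what keeps [Delta] below 1. *)
have w2 : w <= 2 by rewrite /w ler_pdivrMr ?mulr_gt0//; lra.
(* With this gap [T * M * Delta ^+ 2 = N / 4], a fixed fraction of the [N - 1] it is subtracted from
   in [Sreg]. *)
pose Delta := Num.sqrt w / 2.
have D0 : 0 < Delta by rewrite divr_gt0// sqrtr_gt0.
have D2 : Delta ^+ 2 = w / 4.
  by rewrite expr_div_n sqr_sqrtr ?ltW// -natrX.
have D1 : Delta <= 1 by have := sqr_ge0 (Delta - 1); nra.
have sqrtE : Num.sqrt (N%:R * T%:R / M%:R) = T%:R * Delta * 2.
  rewrite (_ : N%:R * T%:R / M%:R = T%:R ^+ 2 * w).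
    by rewrite sqrtrM ?sqr_ge0// sqrtr_sqr gtr0_norm// /Delta; field.
  by rewrite /w; field; rewrite !lt0r_neq0.
have [reg [regE Sreg]] := sum_regret_spike A M1 T1 D0.
have TD := mulr_gt0 Tgt0 D0.
(* Averaging over [j]: [(N - 1 - N / 4) / 2 >= N / 8] for [N >= 2], so the mean regret is at least
   [T%:R * Delta / 8]; the weaker 1/16 makes the contradiction strict. *)
have [j hj] : exists j, T%:R * Delta / 16 <= reg j.
  apply: contrapT => /forallNP h.
  have : \sum_j reg j <= \sum_(j < N) T%:R * Delta / 16.
    by apply: ler_sum => j _; rewrite leNgt; apply/negP => /ltW; exact: h.
  rewrite sumr_const card_ord -mulr_natr => Sle.
  have TMD : T%:R * M%:R * Delta ^+ 2 = N%:R / 4.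
    by rewrite D2 /w; field; rewrite !lt0r_neq0.
  by rewrite TMD in Sreg; nra.
exists (spike M Delta j); split; first exact: rank_spike.
split=> [i j'|].
  have /andP[-> h] := spike_itv j i j' (ltW D0); exact: le_trans h D1.
rewrite regE lee_fin sqrtE; apply: le_trans hj.
by rewrite fmorph_div /= ratr_nat (ratr_nat R 1); lra.
Qed.
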